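(* Let $D$ be a finite digraph and $\alpha=(\alpha_v)_{v\in V(D)}$ a family of mutually disjoint finite digraphs. If $D$ is kernel-perfect and each $\alpha_v$ has a semi-Grundy function, then the Cartesian product $\sigma(D,\alpha)$ has a semi-Grundy function.
   Context: All digraphs are finite. For a vertex $x$ of a digraph $D$, $\Gamma^+(x)$ denotes the set of out-neighbours of $x$. A function $s:V(D)\to\mathbb{N}$ (with $\mathbb{N}=\{0,1,2,\dots\}$) is a semi-Grundy function of $D$ if (1) whenever $s(x)=k$, every $y\in\Gamma^+(x)$ satisfies $s(y)\neq k$; and (2) whenever $s(x)=k$, $y\in\Gamma^+(x)$ and $s(y)>k$, there exists $z\in\Gamma^+(y)$ with $s(z)=k$. A set $I\subseteq V(D)$ is independent if no arc has both ends in $I$; a kernel of $D$ is an independent set $N$ such that every vertex not in $N$ has an arc to some vertex of $N$; $D$ is kernel-perfect if every induced subdigraph of $D$ has a kernel. Given a digraph $D$ and a family $\alpha=(\alpha_v)_{v\in V(D)}$ of mutually disjoint digraphs, the Cartesian product $\sigma(D,\alpha)$ is the digraph with vertex set $\bigcup_{v\in V(D)}V(\alpha_v)$ and arc set $\bigcup_{v\in V(D)}A(\alpha_v)\cup\{(x,y): x\in V(\alpha_u),\ y\in V(\alpha_v),\ (u,v)\in A(D)\}$. *)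

(* Defs.v *)
From HB Require Import structures.
From mathcomp Require Import all_boot.

Set Implicit Arguments.
Unset Strict Implicit.
Unset Printing Implicit Defensive.

(* Loops are not excluded. This is harmless: a vertex with a loop rules out
   kernel-perfectness and the existence of a semi-Grundy function. *)
Record digraph := Digraph { vertex :> finType; arc : rel vertex }.

Definition out_nbrs (D : digraph) (x : D) : {set D} := [set y | arc x y].

Definition semi_grundy (D : digraph) (s : D -> nat) : Prop :=
  (forall (x : D) (k : nat), s x = k ->
     forall y, y \in out_nbrs x -> s y <> k) /\
  (forall (x : D) (k : nat), s x = k ->
     forall y, y \in out_nbrs x -> k < s y ->
     exists2 z, z \in out_nbrs y & s z = k).

Definition has_semi_grundy (D : digraph) : Prop :=
  exists s : D -> nat, semi_grundy s.

Definition independent (D : digraph) (I : {set D}) : Prop :=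
  forall x y, arc x y -> ~ (x \in I /\ y \in I).

Definition is_kernel (D : digraph) (N : {set D}) : Prop :=
  independent N /\
  (forall x, x \notin N -> exists2 y, y \in N & arc x y).

Definition has_kernel (D : digraph) : Prop :=
  exists N : {set D}, is_kernel N.

Definition induced (D : digraph) (S : {set D}) : digraph :=
  @Digraph {x : D | x \in S} (fun x y => arc (val x) (val y)).

Definition kernel_perfect (D : digraph) : Prop :=
  forall S : {set D}, has_kernel (induced S).

(* The union of the mutually disjoint vertex sets V(alpha v) is the tagged sum
   of the types [alpha v]. [tagged_as x y] is [tagged y] seen as a vertex of
   [alpha (tag x)], which is meaningful when [tag x == tag y]. *)
Definition sigma_arc (D : digraph) (alpha : D -> digraph) :
    rel {v : D & alpha v} :=
  fun x y =>
    ((tag x == tag y) && arc (tagged x) (tagged_as x y))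
    || arc (tag x) (tag y).

Definition sigma_digraph (D : digraph) (alpha : D -> digraph) : digraph :=
  @Digraph {v : D & alpha v} (@sigma_arc D alpha).

Lemma sigma_arcP (D : digraph) (alpha : D -> digraph)
    (x y : sigma_digraph alpha) :
  arc x y <->
    (exists (v : D) (a b : alpha v),
       [/\ x = Tagged (fun v => alpha v) a,
           y = Tagged (fun v => alpha v) b & arc a b])
    \/ arc (tag x) (tag y).
Proof.
rewrite /= /sigma_arc; split.
  case/orP => [/andP[]|]; last by right.
  case: x y => [u a] [w b] /= /eqP e; subst w.
  rewrite tagged_asE => ab; left; by exists u, a, b.
case=> [[v [a [b [-> -> ab]]]]|->]; last by rewrite orbT.
by rewrite /= eqxx tagged_asE ab.
Qed.

(* Main.v *)
From mathcomp Require Import all_boot.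
Require Import Defs.

Set Implicit Arguments.
Unset Strict Implicit.
Unset Printing Implicit Defensive.

(** Level [0] of a semi-Grundy function is a local kernel: an independent set
    with a return arc from every out-neighbour outside it. Level [k] is a local
    kernel of what remains once the lower levels are removed, so a digraph has
    a semi-Grundy function as soon as local kernels can be peeled off until
    nothing is left.

    In the product, fix a semi-Grundy function on each factor and only keep
    remainders whose trace on each factor is an upper set for it. Take a kernel
    of the subdigraph of [D] induced by the factors not yet exhausted; the
    lowest remaining levels of the factors in that kernel form a local kernel
    of the remainder, and removing it leaves upper sets. *)

(** [f] is total on [G], but only its values on [R] matter; requiring [z] in [R] makes this the
    condition for the subdigraph induced by [R]. *)
Definition semi_grundy_on (G : digraph) (R : {set G}) (f : G -> nat) : Prop :=
  forall x y, x \in R -> y \in R -> arc x y ->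
    f x <> f y /\
    (f x < f y -> exists z, [/\ z \in R, arc y z & f z = f x]).

(** A semikernel of the subdigraph induced by [R]; nonemptiness makes the peeling terminate. *)
Definition local_kernel (G : digraph) (R N : {set G}) : Prop :=
  [/\ N \subset R, N != set0, independent N &
      forall x y, x \in N -> y \in R -> y \notin N -> arc x y ->
        exists2 z, z \in N & arc y z].

Lemma semi_grundy_onT (G : digraph) (f : G -> nat) :
  semi_grundy_on [set: G] f -> semi_grundy f.
Proof.
move=> fP; split=> x _ <- y; rewrite inE => xy.
  by have [/nesym] := fP x y (in_setT _) (in_setT _) xy.
have [_ /[apply] -[z [_ yz fz]]] := fP x y (in_setT _) (in_setT _) xy.
by exists z; rewrite ?inE.
Qed.

Lemma semi_grundy_on_peel (G : digraph) (P : {set G} -> Prop) :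
  (forall R, P R -> R != set0 ->
     exists2 N, local_kernel R N & P (R :\: N)) ->
  forall R, P R -> exists f, semi_grundy_on R f.
Proof.
move=> step R; have [n] := ubnP #|R|; elim: n R => // n IHn R leRn PR.
have [->|R0] := eqVneq R set0; first by exists (fun=> 0) => x y; rewrite inE.
have [N [sNR N0 Nind Nabs] PRN] := step R PR R0.
have ltRN : #|R :\: N| < n.
  apply: leq_trans (leRn : #|R| <= n).
  by rewrite cardsD (setIidPr sNR) ltn_subrL !card_gt0 N0.
have [f fP] := IHn _ ltRN PRN.
(* Arcs leaving [N] are answered by the local kernel, arcs entering [N] go down in level, and arcs
   outside [N] inherit from [f], as the shift preserves comparisons. *)
exists (fun x => if x \in N then 0 else (f x).+1) => x y xR yR xy.
case: (boolP (x \in N)) (boolP (y \in N)) => [xN|xN] [yN|yN] //.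
- by case: (Nind x y xy).
- split=> // _; have [z zN yz] := Nabs x y xN yR yN xy.
  by exists z; rewrite zN (subsetP sNR).
have [||fxy fz] := fP x y _ _ xy; rewrite ?inE ?xN ?yN //.
split=> [[]//|/fz[z []]]; rewrite inE => /andP[zN zR] yz fzx.
by exists z; rewrite (negbTE zN) fzx.
Qed.

Lemma kernel_perfect_sub (D : digraph) : kernel_perfect D ->
  forall S : {set D}, exists K : {set D},
    [/\ K \subset S, independent K &
        forall x, x \in S -> x \notin K -> exists2 y, y \in K & arc x y].
Proof.
move=> hD S; have [K [Kind Kabs]] := hD S.
exists (val @: K); split.
- by apply/subsetP=> _ /imsetP[x _ ->]; apply: valP.
- move=> _ _ /[swap] -[/imsetP[x xK ->] /imsetP[y yK ->]] xy.
  exact: (Kind x y xy).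
move=> x xS xK; have [|y yK xy] := Kabs (Sub x xS).
  by apply: contra xK => xK; apply/imsetP; exists (Sub x xS).
by exists (val y) => //; apply: imset_f.
Qed.

Section Product.

Variables (D : digraph) (alpha : D -> digraph).
Variable s : forall v : D, alpha v -> nat.
Hypothesis hD : kernel_perfect D.
Hypothesis sP : forall v, semi_grundy (@s v).

Let G := sigma_digraph alpha.
Let lev (x : G) := s (tagged x).

(** The invariant of the peeling: a return vertex supplied by a factor has the level of a vertex
    still in [R], so it has not been removed. *)
Definition fibrewise_upper (R : {set G}) : Prop :=
  forall x y : G, x \in R -> tag x = tag y -> lev x <= lev y -> y \in R.

Definition lowest_over (R : {set G}) (K : {set D}) : {set G} :=
  [set x in R | (tag x \in K) &&
     [forall y in R, (tag y == tag x) ==> (lev x <= lev y)]].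

Lemma lowest_overP (R : {set G}) (K : {set D}) (x : G) :
  reflect [/\ x \in R, tag x \in K &
             forall y, y \in R -> tag y = tag x -> lev x <= lev y]
          (x \in lowest_over R K).
Proof.
rewrite inE; apply: (iffP and3P) => -[xR xK xmin]; split=> //.
  by move=> y yR /eqP yx; move/forall_inP: xmin => /(_ y yR)/implyP; apply.
by apply/forall_inP=> y yR; apply/implyP=> /eqP; apply: xmin.
Qed.

Lemma lowest_over_inhabited (R : {set G}) (K : {set D}) (v : D) :
  K \subset tag @: R -> v \in K -> exists2 x, x \in lowest_over R K & tag x = v.
Proof.
move=> KR vK; have /imsetP[x0 x0R vx0] := subsetP KR v vK.
pose P := [pred x : G | (x \in R) && (tag x == v)].
have Px0 : P x0 by rewrite /= x0R vx0 eqxx.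
have [x /andP[xR /eqP xv] xmin] := arg_minnP lev Px0.
exists x => //; apply/lowest_overP; split; rewrite ?xv // => y yR yv.
by apply: xmin; rewrite /= yR yv eqxx.
Qed.

(** If [y] is lowest in its factor, then so is any remaining [x] of that factor with
    [lev x <= lev y]; hence [x] is removed along with [y]. *)
Lemma fibrewise_upper_peel (R : {set G}) (K : {set D}) :
  fibrewise_upper R -> fibrewise_upper (R :\: lowest_over R K).
Proof.
move=> upR x y; rewrite !inE => /andP[/negP xN xR] xy lexy.
have yR := upR x y xR xy lexy; rewrite yR andbT /=.
apply/negP=> /andP[yK /forall_inP ymin]; apply: xN; rewrite xR xy yK /=.
apply/forall_inP=> z zR; apply/implyP=> zy.
by apply: leq_trans lexy _; move/implyP: (ymin z zR); apply.
Qed.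

Lemma lowest_over_local_kernel (R : {set G}) (K : {set D}) :
  fibrewise_upper R -> R != set0 -> K \subset tag @: R -> independent K ->
  (forall v, v \in tag @: R -> v \notin K -> exists2 w, w \in K & arc v w) ->
  local_kernel R (lowest_over R K).
Proof.
move=> upR /set0Pn[x0 x0R] KR Kind Kabs; split.
- by apply/subsetP=> x /lowest_overP[].
- have [v vK] : exists v, v \in K.
    have [|x0K] := boolP (tag x0 \in K); first by exists (tag x0).
    by have [|v vK _] := Kabs _ _ x0K; [apply: imset_f | exists v].
  have [x xN _] := lowest_over_inhabited KR vK.
  by apply/set0Pn; exists x.
- move=> x y /sigma_arcP xy [/lowest_overP[xR xK xmin] /lowest_overP[yR yK ymin]].
  case: xy => [[v [a [b [ex ey ab]]]]|/Kind]; last by case.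
  subst x y.
  have [/(_ a _ erefl b) sab _] := sP v; apply: sab; rewrite ?inE //.
  by apply/eqP; rewrite eqn_leq (xmin _ yR) // (ymin _ xR).
move=> x y xN yR yN /sigma_arcP xy; have [xR xK xmin] := lowest_overP _ _ _ xN.
case: xy => [[v [a [b [ex ey ab]]]]|xy].
  subst x y.
  (* Otherwise [b] would be as low as [a] and so lie in the local kernel. *)
  have ltab : s a < s b.
    rewrite ltnNge; apply: contra yN => leba; apply/lowest_overP; split=> //.
    by move=> z zR zv; apply: leq_trans leba (xmin z zR zv).
  have [_ /(_ a _ erefl b)] := sP v; rewrite inE => /(_ ab ltab) [c].
  rewrite inE => bc sca; pose z : G := Tagged (fun v => alpha v) c.
  have zx : lev z = s a by [].
  exists z; last by apply/sigma_arcP; left; exists v, b, c.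
  apply/lowest_overP; split=> //; last by rewrite zx; apply: xmin.
  by apply: upR xR _ _; rewrite // zx.
(* As [K] is independent, [tag y] lies outside it and is absorbed by some [w] in [K]; every vertex
   over [w] is then an out-neighbour of [y]. *)
have [||w wK yw] := Kabs (tag y); first exact: imset_f.
  by apply/negP=> yK; case: (Kind _ _ xy).
have [z zN zw] := lowest_over_inhabited KR wK.
by exists z => //; apply/sigma_arcP; right; rewrite zw.
Qed.

Lemma sigma_has_semi_grundy : has_semi_grundy G.
Proof.
have [|//|f fP] := @semi_grundy_on_peel G fibrewise_upper _ [set: G].
  move=> R upR R0; have [K [KR Kind Kabs]] := kernel_perfect_sub hD (tag @: R).
  exists (lowest_over R K); first exact: lowest_over_local_kernel.
  exact: fibrewise_upper_peel.
by exists f; apply: semi_grundy_onT.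
Qed.

End Product.

Theorem theorem5 (D : digraph) (alpha : D -> digraph)
    (hD : kernel_perfect D)
    (halpha : forall v : D, has_semi_grundy (alpha v)) :
  has_semi_grundy (sigma_digraph alpha).
Proof.
have [s sP] := fin_all_exists halpha.
exact: sigma_has_semi_grundy hD sP.
Qed.
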